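(* Let $f:\mathbb{N}\to\mathbb{N}$ be a function. Then the following two conditions are equivalent: (i) for all positive natural numbers $m,n$, $\;f(\gcd(m,n))=\gcd(f(m),f(n))$; (ii) for all positive natural numbers $x,y$, $\;\gcd(f(x),f(y))=\gcd(f(x+y),f(y))$.
   Context: $\mathbb{N}$ denotes the natural numbers including $0$. The greatest common divisor is taken with respect to the divisibility ordering on $\mathbb{N}$, i.e. $\gcd(m,n)$ is the unique natural number such that, for all $k\in\mathbb{N}$, $k\mid m$ and $k\mid n$ if and only if $k\mid \gcd(m,n)$; in particular $\gcd(m,0)=m$ and $\gcd(0,0)=0$. *)

(* Defs.v *)
From mathcomp Require Import all_boot.

(* Main.v *)
Require Import Defs.
From mathcomp Require Import all_boot.

(** Condition (ii) says that [f] respects one step of subtractive Euclid, gcd(x + y, y) = gcd(x, y).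
    Given (i), it is this identity pushed through [f]; conversely, iterating the step brings the two
    arguments to equality, where (i) is trivial. *)

Theorem mainTheorem1 (f : nat -> nat) :
  (forall m n : nat, 0 < m -> 0 < n -> f (gcdn m n) = gcdn (f m) (f n)) <->
  (forall x y : nat, 0 < x -> 0 < y ->
     gcdn (f x) (f y) = gcdn (f (x + y)) (f y)).
Proof.
split=> [fgcd x y x_gt0 y_gt0 | fD m n].
  by rewrite -!fgcd ?addn_gt0 ?x_gt0 // gcdnC -gcdnDr gcdnC.
(* Subtractive Euclid: induction on a bound for m + n. *)
have [k] := ubnP (m + n); elim: k => // k IHk in m n *.
wlog le_mn : m n / m <= n => [IHmn | ].
  have [/IHmn // | lt_nm] := leqP m n.
  by rewrite addnC gcdnC [RHS]gcdnC => ? ? ?; apply: IHmn; rewrite // ltnW.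
rewrite ltnS => le_k m_gt0 n_gt0.
move: le_mn; rewrite leq_eqVlt => /predU1P[<- | lt_mn]; first by rewrite !gcdnn.
have d_gt0 : 0 < n - m by rewrite subn_gt0.
have En : n = (n - m) + m by rewrite subnK // ltnW.
(* Both sides pass from [(m, n)] to [(m, n - m)], whose sum [n] is below [m + n] because [m > 0]. *)
rewrite [RHS]gcdnC [in RHS]En -fD // [RHS]gcdnC {1}En gcdnDr.
by rewrite IHk // subnKC ?(ltnW lt_mn) // (leq_trans _ le_k) // -[ltnLHS]add0n ltn_add2r.
Qed.
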